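(* For all connected simply connected complex semisimple Lie groups $G$, parabolic subgroups $P\supseteq B_+$ and pairs of Weyl group elements $(v,w)\in\mathcal{ECR}_P(W)$, the $P$-Bruhat order interval $[v,w]_P$ is identical with the Bruhat order interval $[v,w]$, meaning that for $v',w'\in W$ $$v\le v'\le w'\le w\iff v\le_Pv'\le_Pw'\le_Pw.$$ This poset is isomorphic to the power set of $\{1,\dots,l(w)-l(v)\}$ with the reverse order (subsets ordered by reverse inclusion).
   Context: $B_\pm$ are fixed opposite Borel subgroups of $G$, $T=B_+\cap B_-$, $\mathfrak t=\mathrm{Lie}\,T$, $W=N_G(T)/T$ acting on $\mathfrak t^*$, with length $l$, Bruhat order $\le$ and covering relation $v\lessdot w\iff v\le w$, $l(v)=l(w)-1$. $W_P$ is the parabolic subgroup of $W$ associated to $P$ and $W^P$ the set of minimal length representatives of $W/W_P$. The $P$-Bruhat order $\le_P$ on $W$ is the (reflexive) transitive closure of the covering relation $v\lessdot_Pw\iff v\lessdot w$ and $vW_P\ne wW_P$. $[v,w]_P$ is the set of $v'\in W$ with $v\le_Pv'\le_Pw$, with the order $\le_P$. $\mathcal{ECR}(W)$ is the set of pairs $(v,w)\in W\times W$ with $v\le w$ and $\dim\operatorname{Ker}(vw^{-1}+1)=l(w)-l(v)$ (kernel in $\mathfrak t^*$), and $\mathcal{ECR}_P(W):=\mathcal{ECR}(W)\cap(W\times W^P)$. *)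

(* Defs.v *)
From Stdlib Require Export Relations.Relation_Operators.
From HB Require Import structures.
From mathcomp Require Export all_boot all_order all_algebra.
From mathcomp Require Export complex.
From mathcomp Require Export boolp classical_sets functions reals.

Set Implicit Arguments.
Unset Strict Implicit.
Unset Printing Implicit Defensive.

Import Order.TTheory GRing.Theory Num.Theory.
Local Open Scope ring_scope.
Local Open Scope classical_set_scope.
Local Open Scope complex_scope.

(* A reduced crystallographic root system in the complex vector space
   V = t^*, with a base.  Root systems with base up to isomorphism correspond
   to triples (G, B_+, T) up to isomorphism, G connected, simply connected,
   complex semisimple: the roots are those of (G, T), and the positive ones are
   the roots of B_+.  Since the roots span V, coroot a is determined by the
   axioms for every root a; its value elsewhere is never used. *)
Record based_root_system (R : realType) (V : vectType R[i]) :=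
  BasedRootSystem {
    roots : seq V;
    coroot : V -> 'Hom(V, R[i]^o);
    simple_roots : seq V;
    roots_span : <<roots>>%VS = fullv;
    roots_neq0 : 0 \notin roots;
    coroot_diag : forall a, a \in roots -> coroot a a = 2;
    roots_refl : forall a b, a \in roots -> b \in roots ->
      b - coroot a b *: a \in roots;
    coroot_int : forall a b, a \in roots -> b \in roots ->
      exists k : int, coroot a b = k%:~R;
    roots_reduced : forall (a : V) (c : R[i]),
      a \in roots -> c *: a \in roots -> c = 1 \/ c = - 1;
    simple_sub : {subset simple_roots <= roots};
    simple_basis : basis_of fullv simple_roots;
    simple_sign : forall b, b \in roots -> exists k : V -> nat,
      b = \sum_(a <- simple_roots) a *+ k a \/
      b = - \sum_(a <- simple_roots) a *+ k a
  }.

Section WeylGroup.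
Variables (R : realType) (V : vectType R[i]) (Phi : based_root_system V).

Definition reflection (a : V) : 'End(V) :=
  linfun (fun b : V => b - coroot Phi a b *: a).

Definition word_prod (s : seq V) : 'End(V) :=
  \big[@comp_lfun _ V V V / \1%VF]_(a <- s) reflection a.

Definition generated_by (S : seq V) : set 'End(V) :=
  [set g | exists2 s : seq V, {subset s <= S} & g = word_prod s].

Definition weyl : set 'End(V) := generated_by (roots Phi).

Definition is_word_size (g : 'End(V)) (n : nat) : Prop :=
  exists s : seq V,
    [/\ {subset s <= simple_roots Phi}, size s = n & g = word_prod s].

(* The default 0 is only reached outside the Weyl group. *)
Definition weyl_length (g : 'End(V)) : nat :=
  xget 0%N [set n | is_word_size g n /\
                    forall m, is_word_size g m -> (n <= m)%N].

Definition bruhat_step (u x : 'End(V)) : Prop :=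
  exists a : V, [/\ a \in roots Phi, x = (u \o reflection a)%VF &
                    (weyl_length u < weyl_length x)%N].

Definition bruhat_le : 'End(V) -> 'End(V) -> Prop :=
  clos_refl_trans _ bruhat_step.

Definition bruhat_cover (v w : 'End(V)) : Prop :=
  bruhat_le v w /\ weyl_length w = (weyl_length v).+1.

(* Parabolic subgroups P containing B_+ correspond to subsets J of the set of
   simple roots: a simple root a is in J iff - a is a root of P. *)
Definition weyl_parabolic (J : seq V) : set 'End(V) := generated_by J.

Definition left_coset (J : seq V) (v : 'End(V)) : set 'End(V) :=
  [set (v \o u)%VF | u in weyl_parabolic J].

Definition min_coset_reps (J : seq V) : set 'End(V) :=
  [set w | weyl w /\
     forall x, left_coset J w x -> (weyl_length w <= weyl_length x)%N].

Definition P_bruhat_cover (J : seq V) (v w : 'End(V)) : Prop :=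
  bruhat_cover v w /\ left_coset J v <> left_coset J w.

Definition P_bruhat_le (J : seq V) : 'End(V) -> 'End(V) -> Prop :=
  clos_refl_trans _ (P_bruhat_cover J).

Definition P_bruhat_interval (J : seq V) (v w : 'End(V)) : set 'End(V) :=
  [set x | [/\ weyl x, P_bruhat_le J v x & P_bruhat_le J x w]].

Definition ECR : set ('End(V) * 'End(V)) :=
  [set vw | [/\ weyl vw.1, weyl vw.2, bruhat_le vw.1 vw.2 &
     \dim (lker ((vw.1 \o vw.2^-1) + \1)%VF) =
       (weyl_length vw.2 - weyl_length vw.1)%N]].

Definition ECR_P (J : seq V) : set ('End(V) * 'End(V)) :=
  ECR `&` [set vw | weyl vw.1 /\ min_coset_reps J vw.2].

End WeylGroup.

(* Main.v *)
From HB Require Import structures.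
From mathcomp Require Import ring zify.
Require Import Defs.

(** Write t_a for the reflection in a root a, and put u = v w^-1 and
    r = l(w) - l(v).  Any Bruhat chain from v to w writes u as a product of
    k <= r reflections t_b, the labels b of its steps.  Since (u - 1)x always
    lies in the span of the labels, the (-1)-eigenspace of u lies there too; it
    has dimension r by hypothesis, so k = r, the labels form a basis of this
    eigenspace, and -1 is the product of their reflections on it.  Peeling off
    one reflection at a time shows that they are pairwise orthogonal
    ([antifixed_word]).  All such products are therefore order-independent, and
    subsets of an orthogonal label set B give 2^r group elements
    t_S w = (product of t_b, b in S) w, from w (S empty) to v (S = B).

    The heart of the proof is that one label set accounts for the whole
    interval: every x with v <= x <= w is some t_S w ([ecr_boolean]).  This goes
    by induction on l(w), with a simple reflection s such that ws < w.
    If vs < v, then vs (ws)^-1 = u, and the induction hypothesis for (vs, ws)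
    applies; an x with xs < x is lifted to xs in [vs, ws], and an x with xs > x
    cannot occur, because it would make v(s) a label up to sign, hence
    v(s) = - w(s) for the simple root s, while v(s) and w(s) are both negative.
    If vs > v, then v <= ws, the pair (v, ws) is again extremal, and [v, w] is [v, ws] together
    with its translate by the new label w(s).

    Each label b satisfies t_b w < w, and orthogonality makes this sign
    condition independent of the subset: t_b t_S w < t_S w whenever b is not
    in S.  The extreme lengths then force l(t_S w) = l(w) - |S|
    ([point_length]), and a dimension count of (-1)-eigenspaces shows that
    t_S w <= t_S' w only if S' is contained in S ([point_le_sub]).  Finally, if
    t_b t_S w and t_S w lay in one coset of W_P, then so would t_b w and w,
    because the right-hand reflection connecting them is the same one in the
    root w^-1(b); but t_b w is shorter than w, against the minimality of w
    ([point_P_cover]).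

    The tools are standard: a root reflection is determined by its root
    ([coroot_uniq]), l(x t_a) > l(x) exactly when x maps the positive root a to
    a positive root ([length_increaseP]), and the lifting property of the Bruhat
    order ([simple_lifting]). *)

Section BasedRootSystem.
Set Implicit Arguments.
Unset Strict Implicit.
Unset Printing Implicit Defensive.
Import Order.TTheory GRing.Theory Num.Theory.
Local Open Scope ring_scope.

Variables (R : realType) (V : vectType (complex R)).
Variable Phi : based_root_system V.
Local Notation C := (complex R).
Local Notation refl := (reflection Phi).
Local Notation wp := (word_prod Phi).
Local Notation len := (weyl_length Phi).
Local Notation ble := (bruhat_le Phi).
Local Notation step := (bruhat_step Phi).
Local Notation X := (in_tuple (simple_roots Phi)).

(** * Roots, reflections and the invariant form *)

Lemma reflectionE a b : refl a b = b - coroot Phi a b *: a.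
Proof.
have lin : linear (fun b : V => b - coroot Phi a b *: a).
  move=> k x y; rewrite linearP /= scalerDl opprD scalerBr -!scalerA.
  by rewrite addrACA.
pose L := GRing.isLinear.Build _ _ _ _ _ lin.
pose f : {linear V -> V} := HB.pack (fun b : V => b - coroot Phi a b *: a) L.
exact: (lfunE f).
Qed.

Lemma word_prod_nil : wp [::] = \1%VF.
Proof. by rewrite /word_prod big_nil. Qed.

Lemma word_prod_cons a s : wp (a :: s) = (refl a \o wp s)%VF.
Proof. by rewrite /word_prod big_cons. Qed.

Lemma word_prod_cat s1 s2 : wp (s1 ++ s2) = (wp s1 \o wp s2)%VF.
Proof.
elim: s1 => [|a s1 IH]; first by rewrite word_prod_nil comp_lfun1l.
by rewrite cat_cons !word_prod_cons IH comp_lfunA.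
Qed.

Lemma word_prod_seq1 a : wp [:: a] = refl a.
Proof. by rewrite word_prod_cons word_prod_nil comp_lfun1r. Qed.

Lemma word_prod_rcons a s : wp (rcons s a) = (wp s \o refl a)%VF.
Proof. by rewrite -cats1 word_prod_cat word_prod_seq1. Qed.

Lemma root_neq0 a : a \in roots Phi -> a != 0.
Proof. by apply: contraTneq => ->; exact: roots_neq0. Qed.

Lemma reflection_root a b :
  a \in roots Phi -> b \in roots Phi -> refl a b \in roots Phi.
Proof. by move=> Ha Hb; rewrite reflectionE; exact: roots_refl. Qed.

Lemma reflection_self a : a \in roots Phi -> refl a a = - a.
Proof.
move=> Ha; rewrite reflectionE coroot_diag// scaler_nat mulr2n opprD addrA.
by rewrite subrr add0r.
Qed.

Lemma root_opp a : a \in roots Phi -> - a \in roots Phi.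
Proof. by move=> Ha; rewrite -(reflection_self Ha); exact: reflection_root. Qed.

Lemma reflectionK a : a \in roots Phi -> (refl a \o refl a)%VF = \1%VF.
Proof.
move=> Ha; apply/lfunP => x; rewrite comp_lfunE id_lfunE.
rewrite [X in refl a X]reflectionE linearB linearZ /= reflection_self//.
by rewrite reflectionE scalerN opprK subrK.
Qed.

Lemma word_prod_root s b :
  {subset s <= roots Phi} -> b \in roots Phi -> wp s b \in roots Phi.
Proof.
elim: s b => [|a s IH] b Hs Hb; first by rewrite word_prod_nil id_lfunE.
rewrite word_prod_cons comp_lfunE; apply: reflection_root.
  by apply: Hs; rewrite mem_head.
by apply: IH => // c Hc; apply: Hs; rewrite inE Hc orbT.
Qed.

Lemma word_prod_revK s :
  {subset s <= roots Phi} -> (wp s \o wp (rev s))%VF = \1%VF.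
Proof.
elim: s => [|a s IH] Hs; first by rewrite word_prod_nil comp_lfun1l.
rewrite rev_cons word_prod_rcons word_prod_cons comp_lfunA.
rewrite -(comp_lfunA _ (wp s)) IH.
  by rewrite comp_lfun1r reflectionK//; apply: Hs; rewrite mem_head.
by move=> c Hc; apply: Hs; rewrite inE Hc orbT.
Qed.

Lemma weyl_root g b : weyl Phi g -> b \in roots Phi -> g b \in roots Phi.
Proof. by case=> s Hs ->; exact: word_prod_root. Qed.

Lemma weyl_lker0 g : weyl Phi g -> lker g == 0%VS.
Proof.
case=> s Hs ->; apply/lker0P => x y E.
have Hr : {subset rev s <= roots Phi} by move=> a; rewrite mem_rev; apply: Hs.
have := word_prod_revK Hr; rewrite revK => K.
by rewrite -[x]id_lfunE -[y]id_lfunE -K !comp_lfunE E.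
Qed.

Lemma weyl_mulVg g : weyl Phi g -> (g^-1 \o g)%VF = \1%VF.
Proof. by move/weyl_lker0/lker0_compVf. Qed.

Lemma weyl_mulgV g : weyl Phi g -> (g \o g^-1)%VF = \1%VF.
Proof. by move/weyl_lker0/lker0_compfV. Qed.

Lemma weylVK g x : weyl Phi g -> (g^-1)%VF (g x) = x.
Proof. by move=> Hg; rewrite -comp_lfunE weyl_mulVg// id_lfunE. Qed.

Lemma weylKV g x : weyl Phi g -> g ((g^-1)%VF x) = x.
Proof. by move=> Hg; rewrite -comp_lfunE weyl_mulgV// id_lfunE. Qed.

Lemma weyl_inv_uniq g h : weyl Phi g -> (g \o h)%VF = \1%VF -> h = (g^-1)%VF.
Proof.
by move=> Hg E; rewrite -[h]comp_lfun1l -(weyl_mulVg Hg) -comp_lfunA E comp_lfun1r.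
Qed.

Lemma weyl_inv g : weyl Phi g -> weyl Phi (g^-1)%VF.
Proof.
move=> Hg; have [s Hs E] := Hg; exists (rev s).
  by move=> a; rewrite mem_rev; apply: Hs.
by rewrite (@weyl_inv_uniq g (wp (rev s)))// E word_prod_revK.
Qed.

Lemma weyl_mul g h : weyl Phi g -> weyl Phi h -> weyl Phi (g \o h)%VF.
Proof.
case=> s Hs -> [t Ht ->]; exists (s ++ t); last by rewrite word_prod_cat.
by move=> a; rewrite mem_cat => /orP[/Hs|/Ht].
Qed.

Lemma weyl_word s : {subset s <= roots Phi} -> weyl Phi (wp s).
Proof. by exists s. Qed.

Lemma weyl_refl a : a \in roots Phi -> weyl Phi (refl a).
Proof.
move=> Ha; rewrite -word_prod_seq1; apply: weyl_word => b.
by rewrite inE => /eqP ->.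
Qed.

(** If f and the coroot of a differ by d at a root b, then alternating the two
    reflections translates b by multiples of d *: a and so produces infinitely
    many roots. *)
Lemma coroot_uniq a (f : 'Hom(V, C^o)) : a \in roots Phi -> f a = 2 ->
  (forall b, b \in roots Phi -> b - f b *: a \in roots Phi) ->
  f =1 coroot Phi a.
Proof.
move=> Ha fa fPhi.
suff E : {in roots Phi, f =1 coroot Phi a}.
  move=> x; have /span_lfunP := E; apply.
  by rewrite roots_span memvf.
move=> b Hb; apply/eqP; rewrite -subr_eq0; apply/negPn/negP => d0.
set d := f b - coroot Phi a b in d0.
have Hn n : b + (n%:R * d) *: a \in roots Phi.
  elim: n => [|n IH]; first by rewrite mul0r scale0r addr0.
  have Z (h : 'Hom(V, C^o)) k : h a = 2 -> h (b + k *: a) = (h b : C) + k * 2.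
    by move=> ha; rewrite linearD linearZ /= ha.
  have := fPhi _ IH; rewrite Z// -addrA -scalerBl => H1.
  have := roots_refl Ha H1; rewrite Z ?coroot_diag// -addrA -scalerBl.
  (* x = f b, c = coroot Phi a b, y = n *)
  suff -> : forall x c y : C,
      y * (x - c) - (x + y * (x - c) * 2) -
      (c + (y * (x - c) - (x + y * (x - c) * 2)) * 2) = (y + 1) * (x - c).
    by rewrite natr1.
  by move=> x c y; ring.
have inj : injective (fun n : nat => b + (n%:R * d) *: a).
  move=> m n /addrI /eqP; rewrite -subr_eq0 -scalerBl scaler_eq0.
  rewrite (negbTE (root_neq0 Ha)) orbF -mulrBl mulf_eq0 (negbTE d0) orbF subr_eq0.
  by rewrite eqr_nat => /eqP.
have U : uniq [seq b + (n%:R * d) *: a | n <- iota 0 (size (roots Phi)).+1].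
  by rewrite map_inj_uniq// iota_uniq.
have /(uniq_leq_size U) : {subset [seq b + (n%:R * d) *: a
      | n <- iota 0 (size (roots Phi)).+1] <= roots Phi}.
  by move=> x /mapP[n _ ->].
by rewrite size_map size_iota ltnn.
Qed.

Lemma coroot_weyl g a x : weyl Phi g -> a \in roots Phi ->
  coroot Phi (g a) (g x) = coroot Phi a x.
Proof.
move=> Hg Ha.
pose f : 'Hom(V, C^o) := (coroot Phi a \o g^-1)%VF.
have E : f =1 coroot Phi (g a).
  apply: coroot_uniq; rewrite ?weyl_root//.
    by rewrite /f comp_lfunE weylVK// coroot_diag.
  move=> b Hb; rewrite /f comp_lfunE.
  have Hb' := weyl_root (weyl_inv Hg) Hb.
  by rewrite -{1}(weylKV b Hg) -linearZ -linearB weyl_root// roots_refl.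
by rewrite -E /f comp_lfunE weylVK.
Qed.

Lemma weyl_conj g a : weyl Phi g -> a \in roots Phi ->
  (g \o refl a)%VF = (refl (g a) \o g)%VF.
Proof.
move=> Hg Ha; apply/lfunP => x; rewrite !comp_lfunE !reflectionE.
by rewrite coroot_weyl// linearB linearZ.
Qed.

Lemma reflectionN a : a \in roots Phi -> refl (- a) = refl a.
Proof.
move=> Ha; have := weyl_conj (weyl_refl Ha) Ha; rewrite reflection_self// => E.
have := congr1 (fun f => f \o refl a)%VF E.
by rewrite -!comp_lfunA reflectionK// !comp_lfun1r => ->.
Qed.

(** The W-invariant form, needed because orthogonality and the sign of a
    coroot value have to be symmetric in the two roots.  The list of roots may
    have repetitions, which would spoil the invariance. *)
Definition root_form (x y : V) : C :=
  \sum_(g <- undup (roots Phi)) (coroot Phi g x : C) * coroot Phi g y.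

Lemma root_formC x y : root_form x y = root_form y x.
Proof. by apply: eq_bigr => g _; rewrite mulrC. Qed.

Lemma root_formB x y z : root_form x (y - z) = root_form x y - root_form x z.
Proof.
rewrite /root_form -sumrB; apply: eq_bigr => g _.
by rewrite linearB mulrBr.
Qed.

Lemma root_formZ x k y : root_form x (k *: y) = k * root_form x y.
Proof.
rewrite /root_form mulr_sumr; apply: eq_bigr => g _.
by rewrite linearZ /= mulrCA.
Qed.

(** A reflection permutes the roots, and coroots are equivariant, so that the
    sum is merely reindexed. *)
Lemma root_form_reflection a x y : a \in roots Phi ->
  root_form (refl a x) (refl a y) = root_form x y.
Proof.
move=> Ha; rewrite /root_form.
have inj : injective (refl a) by apply/lker0P/weyl_lker0/weyl_refl.
rewrite [RHS](perm_big [seq refl a g | g <- undup (roots Phi)]) /=.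
  rewrite big_map big_seq [RHS]big_seq; apply: eq_bigr => g.
  rewrite mem_undup => Hg.
  have K z : refl a (refl a z) = z by rewrite -comp_lfunE reflectionK// id_lfunE.
  rewrite -(coroot_weyl (refl a x) (weyl_refl Ha) Hg).
  by rewrite -(coroot_weyl (refl a y) (weyl_refl Ha) Hg) !K.
have U : uniq [seq refl a g | g <- undup (roots Phi)].
  by rewrite map_inj_uniq// undup_uniq.
rewrite perm_sym; apply: uniq_perm => //; first exact: undup_uniq.
apply: (uniq_min_size U _ _).2; last by rewrite size_map.
by move=> b /mapP[g]; rewrite !mem_undup => Hg ->; exact: reflection_root.
Qed.

Lemma root_form_gt0 a : a \in roots Phi -> 0 < root_form a a.
Proof.
move=> Ha; rewrite /root_form (bigD1_seq a) ?mem_undup ?undup_uniq//=.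
apply: ltr_pwDl; first by rewrite coroot_diag// mulr_gt0.
rewrite big_seq_cond; apply: sumr_ge0 => g /andP[]; rewrite mem_undup => Hg _.
have [k ->] := coroot_int Hg Ha; rewrite -intrM ler0z; nia.
Qed.

(** Invariance under the reflection in a, which negates a, evaluated on the
    pair (a, y). *)
Lemma coroot_form a y : a \in roots Phi ->
  coroot Phi a y * root_form a a = 2 * root_form a y.
Proof.
move=> Ha; have := root_form_reflection a y Ha.
rewrite [refl a y]reflectionE root_formB root_formZ.
rewrite ![root_form (refl a a) _]root_formC (reflection_self Ha) -scaleN1r.
rewrite !root_formZ ![root_form _ a]root_formC.
by move=> E; rewrite mulr_natl mulr2n -{1}E; ring.
Qed.

Lemma coroot_gt0_sym a b : a \in roots Phi -> b \in roots Phi ->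
  (0 < (coroot Phi a b : C)) = (0 < (coroot Phi b a : C)).
Proof.
move=> Ha Hb.
rewrite -(pmulr_lgt0 (coroot Phi a b : C) (root_form_gt0 Ha)).
rewrite -(pmulr_lgt0 (coroot Phi b a : C) (root_form_gt0 Hb)).
by rewrite !coroot_form// !pmulr_rgt0// (root_formC a).
Qed.

Lemma coroot_eq0_sym a b : a \in roots Phi -> b \in roots Phi ->
  ((coroot Phi a b : C) == 0) = ((coroot Phi b a : C) == 0).
Proof.
move=> Ha Hb.
have H c d : c \in roots Phi ->
    ((coroot Phi c d : C) == 0) = (root_form c d == 0).
  move=> Hc; have E := coroot_form d Hc.
  have n0 : root_form c c != 0 by rewrite gt_eqF// root_form_gt0.
  apply/eqP/eqP => z; move: E; rewrite z (mulr0, mul0r).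
    by move/esym/eqP; rewrite mulf_eq0 pnatr_eq0 => /eqP.
  by move/eqP; rewrite mulf_eq0 (negbTE n0) orbF => /eqP.
by rewrite !H// (root_formC a).
Qed.

(** * Positive roots and the length function *)

(** The sum of the coordinates in the simple roots.  As the coordinates of a
    root all have the same sign, its height decides whether it is positive. *)
Definition height (x : V) : C := \sum_i coord X i x.

Definition positive b := (b \in roots Phi) && (0 < height b).

Lemma simple_free : free X.
Proof. exact: basis_free (simple_basis Phi). Qed.

Lemma coord_simpleE x : x = \sum_i coord X i x *: X`_i.
Proof. exact: (@coord_basis _ _ _ _ X _ (simple_basis Phi) (memvf x)). Qed.

Lemma heightN x : height (- x) = - height x.
Proof. by rewrite /height -sumrN; apply: eq_bigr => i _; rewrite linearN. Qed.

Lemma heightBZ x k y : height (x - k *: y) = height x - k * height y.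
Proof.
rewrite /height mulr_sumr -sumrB; apply: eq_bigr => i _.
by rewrite linearB linearZ.
Qed.

Lemma positive_root b : positive b -> b \in roots Phi.
Proof. by case/andP. Qed.

Lemma positiveN b : positive b -> ~~ positive (- b).
Proof.
by case/andP=> Hb hb; rewrite negb_and heightN oppr_gt0 lt_gtF ?orbT.
Qed.

Lemma simpleP a : a \in simple_roots Phi ->
  exists i : 'I_(size (simple_roots Phi)), a = X`_i.
Proof.
by case/seq_tnthP => i ->; exists i; rewrite (tnth_nth 0).
Qed.

Lemma simple_positive a : a \in simple_roots Phi -> positive a.
Proof.
move=> Ha; rewrite /positive simple_sub//=; have [i ->] := simpleP Ha.
rewrite /height (bigD1 i)//= coord_free ?simple_free// eqxx big1 ?addr0 ?ltr01//.
by move=> j /negbTE nj; rewrite coord_free ?simple_free// eq_sym nj.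
Qed.

Lemma root_coord b : b \in roots Phi ->
  exists n : 'I_(size (simple_roots Phi)) -> nat,
  (forall i, coord X i b = (n i)%:R) \/ (forall i, coord X i b = - (n i)%:R).
Proof.
move=> Hb; have [k kE] := simple_sign Hb; exists (fun i => k X`_i).
have E i : coord X i (\sum_(a <- simple_roots Phi) a *+ k a) = (k X`_i)%:R.
  rewrite (big_nth 0) big_mkord.
  under eq_bigr do rewrite -scaler_nat.
  by rewrite (@coord_sum_free _ _ _ X (fun i => (k X`_i)%:R)) ?simple_free.
by case: kE => ->; [left|right] => i; rewrite ?linearN /= E.
Qed.

Lemma positive_coord b : positive b ->
  exists n : 'I_(size (simple_roots Phi)) -> nat, forall i, coord X i b = (n i)%:R.
Proof.
case/andP => Hb; have [n [H|H]] := root_coord Hb; first by exists n.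
have : height b <= 0.
  by rewrite /height sumr_le0// => i _; rewrite H oppr_le0 ler0n.
by move=> le0 /lt_le_trans/(_ le0); rewrite ltxx.
Qed.

Lemma root_positive_or b : b \in roots Phi -> positive b \/ positive (- b).
Proof.
move=> Hb; rewrite /positive Hb root_opp//= heightN.
have [n H] := root_coord Hb.
have [i ni] : exists i, (0 < n i)%N.
  apply: contrapT => H0; have := root_neq0 Hb; rewrite [b]coord_simpleE.
  rewrite big1 ?eqxx// => i _.
  have ni : n i = 0%N.
    by apply/eqP; rewrite -leqn0 leqNgt; apply/negP=> K; apply: H0; exists i.
  by case: H => ->; rewrite ni ?oppr0 scale0r.
have S : (0 : C) < \sum_i (n i)%:R.
  rewrite (bigD1 i)//= ltr_pwDl ?ltr0n// sumr_ge0// => j _; exact: ler0n.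
case: H => H; [left|right]; rewrite /height.
  by under eq_bigr do rewrite H.
by under eq_bigr do rewrite H; rewrite sumrN opprK.
Qed.

(** Only the coordinate at a changes under the reflection in a, and by
    reducedness b has a positive coordinate elsewhere. *)
Lemma simple_reflection_positive a b : a \in simple_roots Phi -> positive b ->
  b != a -> positive (refl a b).
Proof.
move=> Ha Pb nba.
have Hr : refl a b \in roots Phi.
  by apply: reflection_root; [exact: simple_sub | exact: positive_root].
have [//|Pn] := root_positive_or Hr; exfalso.
have [i aE] := simpleP Ha.
have [n nE] := positive_coord Pb.
have [m mE] := positive_coord Pn.
have n0 j : j != i -> n j = 0%N.
  move=> nji; have := mE j.
  rewrite reflectionE opprB linearB linearZ /= aE coord_free ?simple_free//.
  rewrite eq_sym (negbTE nji) mulr0 sub0r nE => /eqP.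
  by rewrite eq_sym -addr_eq0 -natrD pnatr_eq0 addn_eq0 => /andP[_ /eqP].
have bE : b = (n i)%:R *: a.
  rewrite [LHS]coord_simpleE (bigD1 i)//= nE -aE big1 ?addr0// => j /n0.
  by rewrite nE => ->; rewrite scale0r.
have Hb := positive_root Pb; rewrite bE in Hb.
case: (roots_reduced (simple_sub Ha) Hb) => E; move: nba bE; rewrite E.
  by rewrite scale1r => /eqP nba /nba.
move=> _; rewrite scaleN1r => bE; move: (positiveN Pb).
by rewrite bE opprK simple_positive.
Qed.

Lemma height_nat b : positive b -> exists n : nat, height b = n%:R.
Proof.
move=> /positive_coord [n nE]; exists (\sum_i n i)%N.
by rewrite natr_sum; apply: eq_bigr => i _.
Qed.

(** Expanding b in simple roots inside coroot b b = 2 > 0 gives a simple root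
    with a positive value under the coroot of b; positivity is symmetric. *)
Lemma exists_simple_coroot_gt0 b : positive b ->
  exists2 a, a \in simple_roots Phi & 0 < (coroot Phi a b : C).
Proof.
move=> Pb; have Hb := positive_root Pb; apply: contrapT => H.
have [n nE] := positive_coord Pb.
have := coroot_diag Hb; rewrite {2}[b]coord_simpleE linear_sum /= => E.
have : (2 : C) <= 0.
  rewrite -E sumr_le0// => i _; rewrite linearZ /= nE.
  rewrite /GRing.scale /= mulr_ge0_le0 ?ler0n//.
  have Hi : X`_i \in simple_roots Phi by rewrite mem_nth.
  have [k kE] := coroot_int Hb (simple_sub Hi).
  rewrite kE lerz0 leNgt; apply/negP => k0; apply: H; exists (X`_i) => //.
  by rewrite (coroot_gt0_sym (simple_sub Hi) Hb) kE ltr0z.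
by rewrite lern0.
Qed.

(** Descent on the height: a simple reflection with a positive coroot value
    lowers it. *)
Lemma positive_conj_simple b : positive b ->
  exists (s : seq V) c, [/\ {subset s <= simple_roots Phi}, c \in simple_roots Phi
    & b = wp s c].
Proof.
move=> Pb; have [n] := height_nat Pb.
elim/ltn_ind: n b Pb => n IH b Pb hb.
have [a Ha cab] := exists_simple_coroot_gt0 Pb.
have [->|nba] := eqVneq b a.
  by exists [::], a; split=> //; rewrite word_prod_nil id_lfunE.
have Pab := simple_reflection_positive Ha Pb nba.
have [m hm] := height_nat Pab.
have lt_mn : (m < n)%N.
  rewrite -(ltr_nat C) -hm -hb reflectionE heightBZ gtrDl oppr_lt0.
  by rewrite mulr_gt0//; case/andP: (simple_positive Ha).
have [s [c [Hs Hc E]]] := IH _ lt_mn _ Pab hm.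
exists (a :: s), c; split=> //.
  by move=> d; rewrite inE => /predU1P[->|/Hs].
rewrite word_prod_cons comp_lfunE -E -comp_lfunE reflectionK ?simple_sub//.
by rewrite id_lfunE.
Qed.

Lemma simple_word_sub (s : seq V) :
  {subset s <= simple_roots Phi} -> {subset s <= roots Phi}.
Proof. by move=> Hs a /Hs /(@simple_sub _ _ Phi). Qed.

Lemma reflection_simple_word a : a \in roots Phi ->
  exists2 s : seq V, {subset s <= simple_roots Phi} & refl a = wp s.
Proof.
move=> Ha.
have {Ha} [b P ->] : exists2 b, positive b & refl a = refl b.
  have [P|P] := root_positive_or Ha; first by exists a.
  by exists (- a) => //; rewrite reflectionN.
have [s [c [Hs Hc ->]]] := positive_conj_simple P.
exists (s ++ c :: rev s).
  by move=> d; rewrite mem_cat inE mem_rev => /or3P[/Hs|/eqP->|/Hs].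
have Hs' := simple_word_sub Hs.
rewrite word_prod_cat word_prod_cons comp_lfunA weyl_conj ?simple_sub//.
  by rewrite -comp_lfunA word_prod_revK// comp_lfun1r.
exact: weyl_word.
Qed.

Lemma weyl_simple_word g : weyl Phi g -> exists n, is_word_size Phi g n.
Proof.
case=> s Hs ->; elim: s Hs => [|a s IH] Hs.
  by exists 0%N, [::].
rewrite word_prod_cons.
have [n [t [Ht _ ->]]] : exists n, is_word_size Phi (wp s) n.
  by apply: IH => b Hb; apply: Hs; rewrite inE Hb orbT.
have [u Hu ->] := reflection_simple_word (Hs _ (mem_head _ _)).
exists (size (u ++ t)), (u ++ t); split=> //; last by rewrite word_prod_cat.
by move=> d; rewrite mem_cat => /orP[/Hu|/Ht].
Qed.

(** Simple reflections generate the Weyl group, so the minimum that defines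
    the length is attained. *)
Lemma weyl_length_spec g : weyl Phi g -> is_word_size Phi g (len g) /\
  forall m, is_word_size Phi g m -> (len g <= m)%N.
Proof.
move=> Hg; apply: (@xgetPex _ 0%N [set n | is_word_size Phi g n /\
  forall m, is_word_size Phi g m -> (n <= m)%N]%classic).
have [n0] := weyl_simple_word Hg; elim/ltn_ind: n0 => n IH Hn.
have [[m [Hm lt_mn]]|H] := pselect (exists m, is_word_size Phi g m /\ (m < n)%N).
  exact: IH lt_mn Hm.
by exists n; split=> // m Hm; rewrite leqNgt; apply/negP => lt; apply: H; exists m.
Qed.

Lemma weyl_length_le (s : seq V) : {subset s <= simple_roots Phi} ->
  (len (wp s) <= size s)%N.
Proof.
move=> Hs; have [_] := weyl_length_spec (weyl_word (simple_word_sub Hs)).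
by apply; exists s.
Qed.

(** Strong exchange.  Applying the letters of s to a from right to left, the
    sign changes at some letter c; as the reflection in c makes only c negative,
    a has become c there, and the reflection in a cancels this letter. *)
Lemma exchange (s : seq V) a : {subset s <= simple_roots Phi} -> positive a ->
  positive (- wp s a) ->
  exists s' : seq V, [/\ {subset s' <= simple_roots Phi}, size s = (size s').+1
    & (wp s \o refl a)%VF = wp s'].
Proof.
move=> + Pa; elim: s => [|c s IH] Hs.
  by rewrite word_prod_nil id_lfunE => /negPn; rewrite positiveN.
have Hc : c \in simple_roots Phi by apply: Hs; rewrite mem_head.
have Hs1 : {subset s <= simple_roots Phi}.
  by move=> d Hd; apply: Hs; rewrite inE Hd orbT.
have Hw := weyl_word (simple_word_sub Hs1).
rewrite word_prod_cons comp_lfunE => N.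
have [P|P] := root_positive_or (weyl_root Hw (positive_root Pa)); last first.
  have [s' [Hs' sz E]] := IH Hs1 P.
  exists (c :: s'); split; last by rewrite word_prod_cons -comp_lfunA E.
    by move=> d; rewrite inE => /predU1P[->|/Hs'].
  by rewrite /= sz.
have [E|ne] := eqVneq (wp s a) c; last first.
  by have := positiveN (simple_reflection_positive Hc P ne); rewrite N.
exists s; split=> //.
rewrite -comp_lfunA weyl_conj ?positive_root// E comp_lfunA reflectionK ?comp_lfun1l//.
exact: simple_sub.
Qed.

Lemma length_decrease x a : weyl Phi x -> positive a -> positive (- x a) ->
  (len (x \o refl a)%VF < len x)%N.
Proof.
move=> Hx Pa N; have [[s [Hs sz E]] _] := weyl_length_spec Hx.
rewrite E in N; have [s' [Hs' sz' E']] := exchange Hs Pa N.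
by rewrite -sz sz' E E' ltnS weyl_length_le.
Qed.

Lemma length_increase x a : weyl Phi x -> positive a -> positive (x a) ->
  (len x < len (x \o refl a)%VF)%N.
Proof.
move=> Hx Pa N; have Ha := positive_root Pa.
have Hxa := weyl_mul Hx (weyl_refl Ha).
have := length_decrease Hxa Pa.
rewrite -comp_lfunA reflectionK// comp_lfun1r; apply.
by rewrite comp_lfunE reflection_self// linearN opprK.
Qed.

Lemma length_increaseP x a : weyl Phi x -> positive a ->
  reflect (positive (x a)) (len x < len (x \o refl a)%VF)%N.
Proof.
move=> Hx Pa; apply: (iffP idP); last exact: length_increase.
have [//|N] := root_positive_or (weyl_root Hx (positive_root Pa)).
by move=> lt; have := length_decrease Hx Pa N; rewrite ltnNge ltnW.
Qed.

(** * Bruhat order and lifting *)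

Lemma mulK_refl (x : 'End(V)) a : a \in roots Phi ->
  ((x \o refl a) \o refl a)%VF = x.
Proof. by move=> Ha; rewrite -comp_lfunA reflectionK// comp_lfun1r. Qed.

Lemma mulKl_refl (x : 'End(V)) a : a \in roots Phi ->
  (refl a \o (refl a \o x))%VF = x.
Proof. by move=> Ha; rewrite comp_lfunA reflectionK// comp_lfun1l. Qed.

Lemma step_weyl x y : weyl Phi x -> step x y -> weyl Phi y.
Proof. by move=> Hx [a [Ha -> _]]; exact: weyl_mul (weyl_refl Ha). Qed.

Lemma bruhat_weyl x y : ble x y -> weyl Phi x -> weyl Phi y.
Proof.
by elim=> [x1 y1 H W|//|x1 y1 z1 _ H1 _ H2 W];
  [exact: step_weyl H|exact/H2/H1].
Qed.

Lemma bruhat_trans x y z : ble x y -> ble y z -> ble x z.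
Proof. exact: rt_trans. Qed.

Lemma step_le x y : step x y -> ble x y.
Proof. exact: rt_step. Qed.

Lemma step_positive x y : step x y ->
  exists a, [/\ positive a, y = (x \o refl a)%VF & (len x < len y)%N].
Proof.
case=> a [Ha -> lt]; have [P|P] := root_positive_or Ha; first by exists a.
by exists (- a); rewrite reflectionN.
Qed.

Lemma step_left x b : weyl Phi x -> b \in roots Phi ->
  (len (refl b \o x)%VF < len x)%N -> step (refl b \o x)%VF x.
Proof.
move=> Hx Hb lt; have Hi := weyl_inv Hx.
have Ha : (x^-1)%VF b \in roots Phi by exact: weyl_root.
exists ((x^-1)%VF b); split=> //.
by rewrite -comp_lfunA (weyl_conj Hx Ha) (weylKV b Hx) mulKl_refl.
Qed.

Section Simple.
Variable s : V.
Hypothesis Hs : s \in simple_roots Phi.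

Let Hsr : s \in roots Phi := simple_sub Hs.
Local Notation "x '`s'" := (x \o refl s)%VF (at level 2, format "x `s").

(** For the root a of the step, x a > 0 and, unless a = s, also the reflected
    root s(a) is positive; since (xs)(s(a)) = x a, the step carries over to
    xs. *)
Lemma step_simple x y : weyl Phi x -> step x y -> y = x `s \/ step (x `s) (y `s).
Proof.
move=> Hx /step_positive [a [Pa -> lt]]; have Ha := positive_root Pa.
have [->|ne] := eqVneq a s; [by left|right].
have Hsa := reflection_root Hsr Ha.
have E : ((x \o refl a) \o refl s)%VF = (x `s \o refl (refl s a))%VF.
  rewrite -!comp_lfunA (weyl_conj (weyl_refl Hsr) Hsa) -[refl s (refl s a)]comp_lfunE.
  by rewrite reflectionK// id_lfunE.
exists (refl s a); split=> //; rewrite E.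
apply: length_increase; first exact: weyl_mul (weyl_refl Hsr).
  exact: simple_reflection_positive.
rewrite -comp_lfunE -comp_lfunA reflectionK// comp_lfun1r.
exact/length_increaseP.
Qed.

(** The lifting property, in a form that is stable under transitivity. *)
Lemma simple_lifting x y : ble x y -> weyl Phi x ->
  ble (x `s) (y `s) \/ (ble (x `s) y /\ ble x (y `s)).
Proof.
elim=> {x y} [x y H|x|x y z xy IH1 yz IH2] W.
- have [E|H'] := step_simple W H; last by left; exact: step_le.
  by right; rewrite E mulK_refl//; split; exact: rt_refl.
- by left; exact: rt_refl.
have [H1|[H1 H1']] := IH1 W; have [H2|[H2 H2']] := IH2 (bruhat_weyl xy W).
- by left; exact: bruhat_trans H2.
- by right; split; [exact: bruhat_trans H2|exact: bruhat_trans H2'].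
- by right; split; [exact: bruhat_trans yz|exact: bruhat_trans H2].
- by right; split; [exact: bruhat_trans yz|exact: bruhat_trans H2'].
Qed.

Lemma simple_step_up x : (len x < len x `s)%N -> step x x `s.
Proof. by exists s. Qed.

Lemma simple_step_down x : (len x `s < len x)%N -> step x `s x.
Proof. by exists s; rewrite mulK_refl. Qed.

Lemma lifting_down x y : weyl Phi x -> ble x y -> (len x `s < len x)%N ->
  ble x `s y `s.
Proof.
move=> W xy lx; have [//|[_ H]] := simple_lifting xy W.
exact: bruhat_trans (step_le (simple_step_down lx)) H.
Qed.

Lemma lifting_up x y : weyl Phi x -> ble x y -> (len x < len x `s)%N ->
  ble x y `s.
Proof.
move=> W xy lx; have [H|[_ //]] := simple_lifting xy W.
exact: bruhat_trans (step_le (simple_step_up lx)) H.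
Qed.

Lemma length_simple_le x : weyl Phi x -> (len x `s <= (len x).+1)%N.
Proof.
move=> /weyl_length_spec [[t [Ht <- ->]] _].
rewrite -word_prod_rcons -(size_rcons t s); apply: weyl_length_le => a.
by rewrite mem_rcons inE => /predU1P[->|/Ht].
Qed.

Lemma simple_down_length x : weyl Phi x -> (len x `s < len x)%N ->
  len x = (len x `s).+1.
Proof.
move=> W lt; apply/eqP; rewrite eqn_leq lt andbT.
have := length_simple_le (weyl_mul W (weyl_refl Hsr)).
by rewrite mulK_refl.
Qed.

Lemma simple_up_or_down x : weyl Phi x ->
  (len x < len x `s)%N \/ (len x `s < len x)%N /\ positive (- x s).
Proof.
move=> W; have Ps := simple_positive Hs.
have [P|P] := root_positive_or (weyl_root W Hsr); first by left; exact: length_increase.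
by right; split=> //; exact: length_decrease.
Qed.

End Simple.

Lemma descent_exists w : weyl Phi w -> (0 < len w)%N ->
  exists2 s, s \in simple_roots Phi & (len (w \o refl s)%VF < len w)%N.
Proof.
move=> /weyl_length_spec [[t [Ht <- ->]] _].
case/lastP: t Ht => // t s Ht _; have Hs : s \in simple_roots Phi.
  by apply: Ht; rewrite mem_rcons mem_head.
exists s => //; rewrite word_prod_rcons mulK_refl ?simple_sub//.
rewrite size_rcons ltnS weyl_length_le// => a Ha.
by apply: Ht; rewrite mem_rcons inE Ha orbT.
Qed.

(** Reads a Bruhat chain from x up to y as a product of left reflections, one
    for each step; every step raises the length. *)
Lemma bruhat_labels x y : ble x y -> weyl Phi x ->
  exists B : seq V, [/\ {subset B <= roots Phi}, x = (wp B \o y)%VF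
    & (size B + len x <= len y)%N].
Proof.
elim=> {x y} [x y [a [Ha yE lt]]|x|x y z xy IH1 yz IH2] W.
- exists [:: x a]; split=> //.
    by move=> b; rewrite inE => /eqP->; exact: weyl_root.
  by rewrite word_prod_seq1 yE weyl_conj// mulKl_refl// weyl_root.
- by exists [::]; split=> //; rewrite word_prod_nil comp_lfun1l.
have [B1 [H1 E1 l1]] := IH1 W; have [B2 [H2 E2 l2]] := IH2 (bruhat_weyl xy W).
exists (B1 ++ B2); split.
- by move=> b; rewrite mem_cat => /orP[/H1|/H2].
- by rewrite E1 E2 word_prod_cat comp_lfunA.
- by rewrite size_cat; lia.
Qed.

Lemma bruhat_length x y : ble x y -> weyl Phi x -> (len x <= len y)%N.
Proof. by move=> xy W; have [B [_ _]] := bruhat_labels xy W; lia. Qed.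

(** * Products of orthogonal reflections *)

Lemma word_prod_sub_span B x : wp B x - x \in <<B>>%VS.
Proof.
elim: B => [|b B IH]; first by rewrite word_prod_nil id_lfunE subrr mem0v.
rewrite word_prod_cons comp_lfunE reflectionE addrAC memvB//.
  by rewrite span_cons; apply: subvP IH; exact: addvSr.
by rewrite memvZ// memv_span// mem_head.
Qed.

Lemma antifixed_sub_span B : (lker (wp B + \1%VF)%R <= <<B>>)%VS.
Proof.
apply/subvP => x; rewrite memv_ker add_lfunE id_lfunE addr_eq0 => /eqP E.
have := word_prod_sub_span B x; rewrite E -opprD memvN -mulr2n -scaler_nat.
by move/(memvZ (2^-1)); rewrite scalerA mulVf ?scale1r ?pnatr_eq0.
Qed.

(** Writing wp B b - b in terms of the free family B forces the coefficients
    to vanish successively. *)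
Lemma fixed_orthogonal (B : seq V) b : free B -> wp B b = b ->
  forall c, c \in B -> coroot Phi c b = 0.
Proof.
elim: B => // c B IH; rewrite free_cons => /andP[cB fB].
rewrite word_prod_cons comp_lfunE reflectionE => E.
have c0 : coroot Phi c (wp B b) = 0.
  apply/eqP/negPn/negP => n0; move/negP: cB; apply.
  have := word_prod_sub_span B b; rewrite -[X in _ - X]E opprB addrCA subrr addr0.
  by move/(memvZ (coroot Phi c (wp B b))^-1); rewrite scalerA mulVf// scale1r.
move: E; rewrite c0 scale0r subr0 => E d; rewrite inE => /predU1P[->|Hd].
  by rewrite -E.
exact: IH.
Qed.

Definition orthogonal_roots (B : seq V) :=
  [/\ {subset B <= roots Phi}, uniq B &
    {in B &, forall a b, a != b -> coroot Phi a b = 0}].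

(** If t_b * wp B is -1 at b, then wp B fixes b; hence b is orthogonal to B,
    and wp B is -1 on B. *)
Lemma antifixed_orthogonal (B : seq V) : {subset B <= roots Phi} -> free B ->
  {in B, forall b, wp B b = - b} -> orthogonal_roots B.
Proof.
move=> HB fB aB; split=> //; first exact: free_uniq.
elim: B HB fB aB => // b B IH HB fbB aB.
have := fbB; rewrite free_cons => /andP[_ fB].
have Hb : b \in roots Phi by apply: HB; rewrite mem_head.
have HB' : {subset B <= roots Phi} by move=> c Hc; apply: HB; rewrite inE Hc orbT.
have wpE x : x \in b :: B -> wp B x = refl b (- x).
  move=> Hx; rewrite -(aB x Hx) word_prod_cons comp_lfunE -comp_lfunE.
  by rewrite reflectionK// id_lfunE.
have bO c : c \in B -> coroot Phi c b = 0.
  apply: fixed_orthogonal => //; rewrite wpE ?mem_head// linearN /=.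
  by rewrite reflection_self// opprK.
have Ob c : c \in B -> coroot Phi b c = 0.
  move=> Hc; have e : (coroot Phi b c == 0) = (coroot Phi c b == 0).
    exact: coroot_eq0_sym Hb (HB' _ Hc).
  by apply/eqP; rewrite e bO.
have {}IH := IH HB' fB.
have {}IH : {in B &, forall a b, a != b -> coroot Phi a b = 0}.
  apply: IH => c Hc; rewrite wpE ?inE ?Hc ?orbT// linearN /= reflectionE Ob//.
  by rewrite scale0r subr0.
move=> c d; rewrite !inE => /predU1P[->|Hc] /predU1P[->|Hd].
- by rewrite eqxx.
- by move=> _; exact: Ob.
- by move=> _; exact: bO.
- exact: IH.
Qed.

Lemma orthogonal_sub B B1 : orthogonal_roots B -> uniq B1 -> {subset B1 <= B} ->
  orthogonal_roots B1.
Proof.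
case=> HB _ oB u s; split=> // [a /s /HB //|a b /s Ha /s Hb]; exact: oB.
Qed.

(** A formula that does not see the order of the factors. *)
Lemma orthogonal_word_prodE B x : orthogonal_roots B ->
  wp B x = x - \sum_(b <- B) coroot Phi b x *: b.
Proof.
elim: B => [|b B IH] oB.
  by rewrite word_prod_nil id_lfunE big_nil subr0.
have [HB /= /andP[bB u] cB] := oB.
have sB : {subset B <= b :: B} by move=> c Hc; rewrite inE Hc orbT.
rewrite word_prod_cons comp_lfunE (IH (orthogonal_sub oB u sB)).
rewrite linearB linear_sum /= reflectionE big_cons opprD addrA; congr (_ - _).
rewrite !big_seq; apply: eq_bigr => c Hc; rewrite linearZ /= reflectionE.
have bc : b != c by apply: contraNneq bB => ->.
by rewrite (cB b c) ?mem_head ?(sB c)// scale0r subr0.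
Qed.

Lemma orthogonal_word_perm B B' : orthogonal_roots B -> perm_eq B B' ->
  wp B = wp B'.
Proof.
move=> oB p; have oB' : orthogonal_roots B'.
  apply: (orthogonal_sub oB); first by rewrite -(perm_uniq p); case: oB.
  by move=> b; rewrite (perm_mem p).
by apply/lfunP => x; rewrite !orthogonal_word_prodE// (perm_big _ p).
Qed.

Lemma orthogonal_wordK B : orthogonal_roots B -> (wp B \o wp B)%VF = \1%VF.
Proof.
move=> oB; rewrite {2}(@orthogonal_word_perm B (rev B))//.
  by rewrite word_prod_revK//; case: oB.
by rewrite perm_sym perm_rev.
Qed.

Lemma orthogonal_word_in B b : orthogonal_roots B -> b \in B -> wp B b = - b.
Proof.
move=> oB Hb; have [HB u cB] := oB.
rewrite orthogonal_word_prodE// (bigD1_seq b)//= coroot_diag ?HB//.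
rewrite big_seq_cond big1 => [|c /andP[Hc nc]]; last by rewrite cB// scale0r.
by rewrite addr0 scaler_nat mulr2n opprD addrA subrr add0r.
Qed.

Lemma orthogonal_word_notin B B1 b : orthogonal_roots B -> uniq B1 ->
  {subset B1 <= B} -> b \in B -> b \notin B1 -> wp B1 b = b.
Proof.
move=> oB u1 s1 Hb nb; have [HB u cB] := oB.
rewrite orthogonal_word_prodE//; last exact: (orthogonal_sub oB).
rewrite big_seq big1 ?subr0// => c Hc.
have cb : c != b by apply: contraNneq nb => <-.
by rewrite (cB c b) ?(s1 c)// scale0r.
Qed.

(** * Extremal pairs *)

Local Opaque weyl_length reflection comp_lfun inv_lfun word_prod.

Definition antifixed_dim (u : 'End(V)) : nat := \dim (lker (u + \1%VF)).

(** A product of k reflections has a (-1)-eigenspace of dimension at most k,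
    and equality occurs only for orthogonal reflections. *)
Lemma antifixed_word B : {subset B <= roots Phi} ->
  (size B <= antifixed_dim (wp B))%N ->
  [/\ orthogonal_roots B, free B & size B = antifixed_dim (wp B)].
Proof.
move=> HB le; have sub := antifixed_sub_span B.
have le1 := dimvS sub; have le2 := dim_span B.
have E : lker (wp B + \1%VF) = <<B>>%VS.
  by apply/eqP; rewrite eqEdim sub (leq_trans le2).
have fB : free B by rewrite /free eqn_leq le2 -E.
split=> //; last by apply/eqP; rewrite eqn_leq le /antifixed_dim E le2.
apply: antifixed_orthogonal => // b Hb; apply/eqP.
rewrite -addr_eq0; have := memv_span Hb.
by rewrite -E memv_ker add_lfunE id_lfunE.
Qed.

Lemma weyl_mulgKV (v w u : 'End(V)) : weyl Phi w -> v = (u \o w)%VF -> (v \o w^-1)%VF = u.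
Proof. by move=> Hw ->; rewrite -comp_lfunA (weyl_mulgV Hw) comp_lfun1r. Qed.

(** Extremal pairs.  The inequality is equivalent to the equality of
    dimensions, by [antifixed_word], and is what has to be checked when passing
    to smaller pairs. *)
Definition ecr (v w : 'End(V)) := [/\ weyl Phi v, weyl Phi w, ble v w
  & (len w - len v <= antifixed_dim (v \o w^-1)%VF)%N].

Lemma ecr_word v w (B : seq V) : ecr v w -> {subset B <= roots Phi} ->
  v = (wp B \o w)%VF -> (size B + len v <= len w)%N ->
  [/\ orthogonal_roots B, free B, (size B + len v)%N = len w
    & (v \o w^-1)%VF = wp B].
Proof.
case=> Hv Hw vw le HB vE sz; have uE := weyl_mulgKV Hw vE.
rewrite uE in le; have lB : (size B <= antifixed_dim (wp B))%N by lia.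
have [o f E] := antifixed_word HB lB; split=> //.
rewrite -E in le; have := bruhat_length vw Hv; move: le sz; clear.
by move: (size B) (len v) (len w); lia.
Qed.

(** A step between v and w belongs to a chain from v to w, so its label is in
    the (-1)-eigenspace. *)
Lemma ecr_antifixed v w y a : ecr v w -> a \in roots Phi ->
  ble v y -> (len y < len (y \o refl a)%VF)%N -> ble (y \o refl a)%VF w ->
  (v \o w^-1)%VF (y a) = - y a.
Proof.
move=> E Ha vy lt yw; have [Hv Hw vw le] := E.
have Hy := bruhat_weyl vy Hv; have Hya := weyl_mul Hy (weyl_refl Ha).
have [B1 [H1 E1 l1]] := bruhat_labels vy Hv.
have [B2 [H2 E2 l2]] := bruhat_labels yw Hya.
have H : {subset B1 ++ y a :: B2 <= roots Phi}.
  move=> b; rewrite mem_cat inE => /or3P[/H1|/eqP->|/H2] //.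
  exact: weyl_root.
have vE : v = (wp (B1 ++ y a :: B2) \o w)%VF.
  rewrite word_prod_cat word_prod_cons -!comp_lfunA -E2 E1; congr (_ \o _)%VF.
  by rewrite comp_lfunA -weyl_conj// mulK_refl.
have sz : (size (B1 ++ y a :: B2) + len v <= len w)%N by rewrite size_cat /=; lia.
have [o _ _ ->] := ecr_word E H vE sz.
by apply: orthogonal_word_in => //; rewrite mem_cat mem_head orbT.
Qed.

Lemma weyl_mulV (v w : 'End(V)) : weyl Phi v -> weyl Phi w ->
  ((v \o w)^-1 = w^-1 \o v^-1)%VF.
Proof.
move=> Hv Hw; apply/esym/(weyl_inv_uniq (weyl_mul Hv Hw)).
by rewrite comp_lfunA -(comp_lfunA v) (weyl_mulgV Hw) comp_lfun1r (weyl_mulgV Hv).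
Qed.

Lemma reflection_inv a : a \in roots Phi -> ((refl a)^-1)%VF = refl a.
Proof.
by move=> Ha; apply/esym/(weyl_inv_uniq (weyl_refl Ha))/reflectionK.
Qed.

(** The step from t_b w s to w s either lifts to the step from t_b w to w or
    has t_b w = w s. *)
Lemma length_left_lift w s b : weyl Phi w -> s \in simple_roots Phi ->
  b \in roots Phi -> (len (w \o refl s)%VF < len w)%N ->
  (len (refl b \o (w \o refl s))%VF < len (w \o refl s)%VF)%N ->
  (len (refl b \o w)%VF < len w)%N.
Proof.
move=> Hw Hs Hb ws bws; have Hr := simple_sub Hs.
have Hws := weyl_mul Hw (weyl_refl Hr).
have e : ((refl b \o (w \o refl s)) \o refl s)%VF = (refl b \o w)%VF.
  by rewrite -comp_lfunA mulK_refl.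
have := step_simple Hs (weyl_mul (weyl_refl Hb) Hws) (step_left Hws Hb bws).
by rewrite e mulK_refl// => -[<- //|[a []]].
Qed.

(** The last condition says that every label is a descent of w; by
    orthogonality it is then a descent at every point of the interval that is
    not yet reflected in it. *)
Definition boolean_labels (v w : 'End(V)) (B : seq V) :=
  [/\ orthogonal_roots B, free B, (size B + len v)%N = len w,
    v = (wp B \o w)%VF &
    {in B, forall b, (len (refl b \o w)%VF < len w)%N}].

(** One orthogonal family serves the whole interval.  The induction removes a
    right descent s of w and uses lifting to move x, v or both along s. *)
Lemma ecr_boolean v w : ecr v w -> exists B, boolean_labels v w B /\
  forall x, ble v x -> ble x w ->
    exists B1, [/\ uniq B1, {subset B1 <= B} & x = (wp B1 \o w)%VF].
Proof.
have [n] := ubnP (len w); elim: n v w => // n IH v w ltn E.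
have [Hv Hw vw le] := E.
have [w0|w0] := posnP (len w).
  have fix0 x : ble x w -> weyl Phi x -> x = w.
    move=> xw Hx; have [[|b B] [_ xE]] := bruhat_labels xw Hx; last by rewrite w0.
    by rewrite xE word_prod_nil comp_lfun1l.
  have vE := fix0 _ vw Hv; exists [::]; split.
    by split; rewrite ?nil_free ?vE ?word_prod_nil ?comp_lfun1l.
  move=> x vx xw; exists [::]; split=> //.
  by rewrite word_prod_nil comp_lfun1l; apply: fix0 => //; exact: bruhat_weyl Hv.
have [s Hs ws] := descent_exists Hw w0.
have Hr := simple_sub Hs.
have lw := simple_down_length Hs Hw ws.
have Hws := weyl_mul Hw (weyl_refl Hr).
have Hvs := weyl_mul Hv (weyl_refl Hr).
have [|[_ wneg]] := simple_up_or_down Hs Hw.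
  by move/(ltn_trans ws); rewrite ltnn.
have [vs|[vs vneg]] := simple_up_or_down Hs Hv; last first.
  (* Here v s < v, and the pair (v s, w s) has the same quotient. *)
  have vsws := lifting_down Hs Hv vw vs.
  have lv := simple_down_length Hs Hv vs.
  have dE : ((v \o refl s) \o (w \o refl s)^-1 = v \o w^-1)%VF.
    rewrite weyl_mulV ?reflection_inv//; last exact: weyl_refl.
    by rewrite comp_lfunA mulK_refl.
  have E' : ecr (v \o refl s)%VF (w \o refl s)%VF.
    split; [exact: Hvs|exact: Hws|exact: vsws|].
    by rewrite dE -subSS -lw -lv.
  have [|B [[o f sz vsE desc] el]] := IH _ _ _ E'; first by lia.
  have vE : v = (wp B \o w)%VF.
    by rewrite -[LHS](mulK_refl v Hr) vsE comp_lfunA (mulK_refl _ Hr).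
  exists B; split.
    split; [exact: o|exact: f| |exact: vE|].
      by rewrite lw -sz lv addnS.
    move=> b Hb; have [HB _ _] := o.
    exact: (length_left_lift Hw Hs (HB b Hb) ws (desc b Hb)).
  move=> x vx xw; have Hx := bruhat_weyl vx Hv.
  have [xs|[xs _]] := simple_up_or_down Hs Hx; last first.
    have [||B1 [u1 s1 xE]] := el (x \o refl s)%VF.
    - exact: lifting_down.
    - exact: lifting_down.
    exists B1; split; [exact: u1|exact: s1|].
    by rewrite -[LHS](mulK_refl x Hr) xE comp_lfunA (mulK_refl _ Hr).
  (* x < x s would put v between v s and w s, with label - v s. *)
  exfalso.
  have xws := lifting_up Hs Hx xw xs.
  have := @ecr_antifixed _ _ (v \o refl s)%VF s E' Hr.
  rewrite (mulK_refl v Hr) => /(_ (rt_refl _ _ _) vs (bruhat_trans vx xws)).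
  rewrite dE [(v \o _)%VF s]comp_lfunE (reflection_self Hr) !linearN /= opprK => K.
  have /(lker0P (weyl_lker0 Hv)) : v ((w^-1)%VF (v s)) = v (- s).
    by rewrite linearN /= -comp_lfunE; apply: oppr_inj; rewrite opprK K.
  move=> /(congr1 w); rewrite (weylKV _ Hw) linearN /= => vwE.
  by move: (positiveN wneg); rewrite -vwE vneg.
(* Here v < v s, and w s is obtained from w by the label b = w s. *)
have vws := lifting_up Hs Hv vw vs.
have [B' [H' E1 l1]] := bruhat_labels vws Hv.
set b := w s; have Hb : b \in roots Phi by exact: weyl_root.
have wsE : (w \o refl s)%VF = (refl b \o w)%VF by exact: weyl_conj.
have [|||o' f' sz' _] := ecr_word (B := rcons B' b) E.
- by move=> c; rewrite mem_rcons inE => /predU1P[->|/H'].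
- by rewrite word_prod_rcons -comp_lfunA -wsE.
- by rewrite size_rcons lw addSn ltnS.
have E' : ecr v (w \o refl s)%VF.
  split; [exact: Hv|exact: Hws|exact: vws|]; rewrite (weyl_mulgKV Hws E1).
  have sub : {subset B' <= rcons B' b} by move=> c Hc; rewrite mem_rcons inE Hc orbT.
  have f'' : free B' by move: f'; rewrite -cats1 => /catl_free.
  have u'' := free_uniq f''.
  have o'' := orthogonal_sub o' u'' sub.
  have : (<<B'>> <= lker (wp B' + \1%VF)%R)%VS.
    apply/span_subvP => c Hc; rewrite memv_ker add_lfunE id_lfunE.
    by rewrite orthogonal_word_in// addNr.
  move/dimvS; rewrite (eqP f'' : \dim <<B'>> = size B'); apply: leq_trans.
  by move: sz'; rewrite size_rcons; lia.
have [|B [[o f sz vE desc] el]] := IH _ _ _ E'; first by lia.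
have vE' : v = (wp (rcons B b) \o w)%VF.
  by rewrite word_prod_rcons -comp_lfunA -wsE.
have HB : {subset rcons B b <= roots Phi}.
  by case: o => HB _ _ c; rewrite mem_rcons inE => /predU1P[->|/HB].
have [|oB fB szB _] := ecr_word E HB vE'; first by rewrite size_rcons; lia.
exists (rcons B b); split.
  split; [exact: oB|exact: fB|exact: szB|exact: vE'|].
  move=> c Hc; have := Hc; rewrite mem_rcons inE => /predU1P[->|Hc'].
    by rewrite -wsE.
  exact: (length_left_lift Hw Hs (HB c Hc) ws (desc c Hc')).
move=> x vx xw; have Hx := bruhat_weyl vx Hv.
have [xs|[xs _]] := simple_up_or_down Hs Hx.
  have [B1 [u1 s1 xE]] := el x vx (lifting_up Hs Hx xw xs).
  exists (rcons B1 b); split.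
  - rewrite rcons_uniq u1 andbT; apply/negP => /s1.
    by have [_ + _] := oB; rewrite rcons_uniq => /andP[/negP].
  - by move=> c; rewrite !mem_rcons !inE => /predU1P[->|/s1->]; rewrite ?eqxx ?orbT.
  - by rewrite word_prod_rcons -comp_lfunA -wsE.
have [||B1 [u1 s1 xE]] := el (x \o refl s)%VF.
- exact: lifting_up.
- exact: lifting_down.
exists B1; split; [exact: u1| |].
  by move=> c /s1; rewrite mem_rcons inE => ->; rewrite orbT.
by rewrite -[LHS](mulK_refl x Hr) xE comp_lfunA (mulK_refl _ Hr).
Qed.

(** * The Boolean interval *)

Lemma weyl_mulgI (g h k : 'End(V)) : weyl Phi g ->
  (g \o h)%VF = (g \o k)%VF -> h = k.
Proof.
move=> Hg /(congr1 (fun f => g^-1 \o f)%VF).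
by rewrite !comp_lfunA (weyl_mulVg Hg) !comp_lfun1l.
Qed.

(** The signs of a and of the root x a decide whether x t_a is shorter
    than x. *)
Lemma length_decrease_congr x y a : weyl Phi x -> weyl Phi y ->
  a \in roots Phi -> x a = y a ->
  (len (x \o refl a)%VF < len x)%N -> (len (y \o refl a)%VF < len y)%N.
Proof.
move=> Hx Hy.
have H c : positive c -> x c = y c ->
    (len (x \o refl c)%VF < len x)%N -> (len (y \o refl c)%VF < len y)%N.
  move=> Pc E lt; apply: (length_decrease Hy Pc).
  have [P|] := root_positive_or (weyl_root Hx (positive_root Pc)); last by rewrite E.
  by have := length_increase Hx Pc P; rewrite ltnNge (ltnW lt).
move=> Ha E; have [Pa|Pa] := root_positive_or Ha; first exact: H.
by rewrite -(reflectionN Ha); apply: H => //; rewrite !linearN /= E.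
Qed.

Section Points.
Variables (v w : 'End(V)) (B : seq V).
Hypotheses (Hw : weyl Phi w) (bl : boolean_labels v w B).

(** Subsets S of B are given by duplicate-free lists B1, and t_S w is then
    [pt B1]. *)
Local Notation pt B1 := (wp B1 \o w)%VF.

Let oB : orthogonal_roots B. Proof. by case: bl. Qed.
Let uB : uniq B. Proof. by case: oB. Qed.
Let HB : {subset B <= roots Phi}. Proof. by case: oB. Qed.

Lemma point_weyl B1 : {subset B1 <= B} -> weyl Phi (pt B1).
Proof. by move=> s; apply: weyl_mul => //; apply: weyl_word => b /s /HB. Qed.

Lemma point_perm B1 B2 : uniq B1 -> {subset B1 <= B} -> perm_eq B1 B2 ->
  pt B1 = pt B2.
Proof.
by move=> u s p; rewrite (orthogonal_word_perm (orthogonal_sub oB u s) p).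
Qed.

(** The reflection is in the same root a = w^-1(b) on the right of w and on
    the right of the point of B1: the labels in B1 are orthogonal to b, so both
    send a to b. *)
Lemma point_cons b B1 : uniq (b :: B1) -> {subset b :: B1 <= B} ->
  let a := (w^-1)%VF b in
  [/\ a \in roots Phi, pt (b :: B1) = (pt B1 \o refl a)%VF,
    (len (w \o refl a)%VF < len w)%N & (len (pt (b :: B1)) < len (pt B1))%N].
Proof.
move=> + s a => /andP[bB1 u1].
have Hb : b \in B by apply: s; rewrite mem_head.
have s1 : {subset B1 <= B} by move=> c Hc; apply: s; rewrite inE Hc orbT.
have Ha : a \in roots Phi by exact: weyl_root (weyl_inv Hw) (HB Hb).
have wa : w a = b by exact: (weylKV b Hw).
have pa : pt B1 a = b.
  by rewrite comp_lfunE wa; exact: (orthogonal_word_notin oB).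
have E : pt (b :: B1) = (pt B1 \o refl a)%VF.
  by rewrite (weyl_conj (point_weyl s1) Ha) pa word_prod_cons comp_lfunA.
have lt : (len (w \o refl a)%VF < len w)%N.
  by rewrite (weyl_conj Hw Ha) wa; case: bl => _ _ _ _; apply.
split; [exact: Ha|exact: E|exact: lt|]; rewrite E.
by apply: (length_decrease_congr Hw (point_weyl s1) Ha _ lt); rewrite pa.
Qed.

Lemma point_length_cat B1 B2 : uniq (B1 ++ B2) -> {subset B1 ++ B2 <= B} ->
  (len (pt (B1 ++ B2)) + size B1 <= len (pt B2))%N.
Proof.
elim: B1 => [|b B1 IH]; first by rewrite addn0.
rewrite cat_cons => u s; have [_ _ _ lt] := point_cons u s.
have : (len (pt (B1 ++ B2)) + size B1 <= len (pt B2))%N.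
  apply: IH => [|c Hc]; first by case/andP: u.
  by apply: s; rewrite inE Hc orbT.
by apply: leq_trans; rewrite /= addnS -addSn leq_add2r.
Qed.

(** Going down from w to v through the point of B1, each of the size B labels
    costs at least one, while the total cost is exactly size B. *)
Lemma point_length B1 : uniq B1 -> {subset B1 <= B} ->
  (len (pt B1) + size B1)%N = len w.
Proof.
move=> u1 s1; have [_ _ sz vE _] := bl.
have pnil : pt [::] = w by rewrite word_prod_nil comp_lfun1l.
have le1 : (len (pt B1) + size B1 <= len w)%N.
  by have := @point_length_cat B1 [::]; rewrite cats0 pnil; apply.
(* Continue from the point of B1 down to v. *)
pose D := [seq b <- B | b \notin B1].
have uD : uniq (D ++ B1).
  rewrite cat_uniq filter_uniq// u1 andbT; apply/hasPn => b Hb.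
  by rewrite mem_filter Hb.
have p : perm_eq (D ++ B1) B.
  apply: uniq_perm => // b; rewrite mem_cat mem_filter.
  by have [/s1|] := boolP (b \in B1); rewrite ?orbF ?orbT.
have sD : {subset D ++ B1 <= B} by move=> b; rewrite (perm_mem p).
have := point_length_cat uD sD.
rewrite (point_perm uD sD p) -vE => le2.
have := perm_size p; rewrite size_cat => szB.
by apply/eqP; rewrite eqn_leq le1 /= -sz -szB addnAC leq_add2r addnC.
Qed.

Variable J : seq V.
Hypothesis wJ : min_coset_reps Phi J w.

(** If both points had the same coset, the reflection in w^-1(b) would lie in
    the parabolic subgroup and would shorten w. *)
Lemma point_P_cover b B1 : uniq (b :: B1) -> {subset b :: B1 <= B} ->
  P_bruhat_cover Phi J (pt (b :: B1)) (pt B1).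
Proof.
move=> u s; have [Ha E wlt lt] := point_cons u s.
have u1 : uniq B1 by case/andP: u.
have s1 : {subset B1 <= B} by move=> c Hc; apply: s; rewrite inE Hc orbT.
set a := (w^-1)%VF b in Ha E wlt.
split.
  split.
    apply: step_le; exists a; split=> //; rewrite E (mulK_refl _ Ha) //.
  have := point_length u s; rewrite -(point_length u1 s1) /= addnS -addSn.
  by move/addIn.
move=> cE.
have : left_coset Phi J (pt B1) (pt B1).
  exists \1%VF; last by rewrite comp_lfun1r.
  by exists [::] => //; rewrite word_prod_nil.
rewrite -cE => -[g Hg gE].
have gE' : g = refl a.
  have Hx := point_weyl s.
  have : (pt (b :: B1) \o g)%VF = (pt (b :: B1) \o refl a)%VF.
    by rewrite gE E (mulK_refl _ Ha).
  exact: weyl_mulgI.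
have [_ /(_ (w \o refl a)%VF)] := wJ.
rewrite leqNgt wlt => H; suff: false by []; apply: H.
by exists g => //; rewrite gE'.
Qed.

Lemma point_P_le B1 B2 : uniq B1 -> {subset B1 <= B} -> uniq B2 ->
  {subset B2 <= B1} -> P_bruhat_le Phi J (pt B1) (pt B2).
Proof.
move=> u1 s1 u2 s21.
pose D := [seq b <- B1 | b \notin B2].
have uD : uniq (D ++ B2).
  rewrite cat_uniq filter_uniq// u2 andbT; apply/hasPn => b Hb.
  by rewrite mem_filter Hb.
have p : perm_eq B1 (D ++ B2).
  rewrite perm_sym; apply: uniq_perm => // b; rewrite mem_cat mem_filter.
  by have [/s21|] := boolP (b \in B2); rewrite ?orbF ?orbT.
rewrite (point_perm u1 s1 p).
have sD : {subset D ++ B2 <= B} by move=> b; rewrite -(perm_mem p) => /s1.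
elim: D uD sD {p} => [|b D IH]; first by move=> *; exact: rt_refl.
rewrite cat_cons => u s; apply: rt_trans (rt_step _ _ _ _ (point_P_cover u s)) _.
apply: IH => [|c Hc]; first by case/andP: u.
by apply: s; rewrite inE Hc orbT.
Qed.

(** The product over B1 and B2 is -1 on the symmetric difference of B1 and
    B2, whose size therefore is at most the difference of the lengths,
    size B1 - size B2. *)
Lemma point_le_sub B1 B2 : uniq B1 -> {subset B1 <= B} -> uniq B2 ->
  {subset B2 <= B} -> ble (pt B1) (pt B2) -> {subset B2 <= B1}.
Proof.
move=> u1 s1 u2 s2 le; have [D [HD DE szD]] := bruhat_labels le (point_weyl s1).
have o1 := orthogonal_sub oB u1 s1; have o2 := orthogonal_sub oB u2 s2.
have {}DE : wp D = (wp B1 \o wp B2)%VF.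
  have /(congr1 (fun f => (f \o w^-1) \o wp B2)%VF) := DE.
  rewrite -!comp_lfunA (comp_lfunA w) (weyl_mulgV Hw) comp_lfun1l.
  by rewrite (orthogonal_wordK o2) comp_lfun1r.
pose E1 := [seq b <- B1 | b \notin B2]; pose E2 := [seq b <- B2 | b \notin B1].
have uE : uniq (E1 ++ E2).
  rewrite cat_uniq !filter_uniq// andbT; apply/hasPn => b.
  by rewrite !mem_filter => /andP[/negbTE -> _]; rewrite andbF.
have sE : {subset E1 ++ E2 <= B}.
  by move=> b; rewrite mem_cat !mem_filter => /orP[/andP[_ /s1]|/andP[_ /s2]].
have fB : free B by case: bl.
have fE : free (E1 ++ E2).
  have p : perm_eq [seq b <- B | b \in E1 ++ E2] (E1 ++ E2).
    apply: uniq_perm => [||b]; rewrite ?filter_uniq// mem_filter.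
    by apply/andP/idP => [[]//|Hb]; split=> //; exact: sE.
  by rewrite -(perm_free p) filter_free.
have sub : (<<E1 ++ E2>> <= lker (wp D + \1%VF)%R)%VS.
  apply/span_subvP => b Hb; rewrite memv_ker add_lfunE id_lfunE DE comp_lfunE.
  have HbB := sE b Hb; move: Hb; rewrite mem_cat !mem_filter.
  case/orP => /andP[n i].
    by rewrite (orthogonal_word_notin oB u2 s2 HbB n) (orthogonal_word_in o1 i) addNr.
  rewrite (orthogonal_word_in o2 i) linearN /=.
  by rewrite (orthogonal_word_notin oB u1 s1 HbB n) addNr.
have := leq_trans (dimvS sub) (leq_trans (dimvS (antifixed_sub_span D)) (dim_span D)).
rewrite (eqP fE : \dim <<E1 ++ E2>> = _) size_cat => szE.
have l1 := point_length u1 s1; have l2 := point_length u2 s2.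
have c1 : size B1 = (count (mem B2) B1 + size E1)%N.
  by rewrite size_filter -(count_predC (mem B2)).
have c2 : size B2 = (count (mem B1) B2 + size E2)%N.
  by rewrite size_filter -(count_predC (mem B1)).
have c12 : count (mem B2) B1 = count (mem B1) B2.
  rewrite -!size_filter; apply/perm_size/uniq_perm; rewrite ?filter_uniq// => b.
  by rewrite !mem_filter andbC.
have E20 : size E2 = 0%N.
  move: szE szD l1 l2; rewrite c1 c2 c12; clear.
  move: (size E1) (size E2) (size D) (count _ _) (len w) => e1 e2 d c n.
  by move: (len _) (len _) => n1 n2; lia.
move=> b Hb; apply/negPn/negP => nb.
have : b \in E2 by rewrite mem_filter nb.
by rewrite (size0nil E20).
Qed.

End Points.

Lemma P_bruhat_le_bruhat J x y : P_bruhat_le Phi J x y -> bruhat_le Phi x y.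
Proof.
elim=> [x1 y1 [[]]//|x1|x1 y1 z _ H1 _ H2]; first exact: rt_refl.
exact: rt_trans H2.
Qed.

(** For the product of the reflections in a subset of B, this is the set of
    positions of that subset. *)
Definition flip_set (B : seq V) n (u : 'End(V)) : {set 'I_n} :=
  [set i : 'I_n | u B`_i == - B`_i].

Lemma flip_setE B B1 n (i : 'I_n) : orthogonal_roots B -> size B = n ->
  uniq B1 -> {subset B1 <= B} ->
  (i \in flip_set B n (word_prod Phi B1)) = (B`_i \in B1).
Proof.
move=> oB sz u1 s1; rewrite inE.
have Bi : B`_i \in B by rewrite mem_nth// sz.
have [HB _ _] := oB.
have [i1|n1] := boolP (B`_i \in B1).
  by rewrite (orthogonal_word_in (orthogonal_sub oB u1 s1) i1) eqxx.
rewrite (orthogonal_word_notin oB u1 s1 Bi n1) -addr_eq0 -mulr2n -scaler_nat.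
by rewrite scaler_eq0 pnatr_eq0 (negbTE (root_neq0 (HB _ Bi))).
Qed.

Lemma flip_set_subset B B1 B2 n : orthogonal_roots B -> size B = n ->
  uniq B1 -> {subset B1 <= B} -> uniq B2 -> {subset B2 <= B} ->
  (flip_set B n (word_prod Phi B2) \subset flip_set B n (word_prod Phi B1))
  <-> {subset B2 <= B1}.
Proof.
move=> oB sz u1 s1 u2 s2; split=> [/fintype.subsetP H b Hb|H].
  have Hi : (index b B < n)%N by rewrite -sz index_mem s2.
  have bE : B`_(index b B) = b by rewrite nth_index// s2.
  by have := H (Ordinal Hi); rewrite !flip_setE//= bE; apply.
by apply/fintype.subsetP => i; rewrite !flip_setE//; exact: H.
Qed.

Lemma flip_set_onto B n (S : {set 'I_n}) : orthogonal_roots B ->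
  size B = n -> exists B1, [/\ uniq B1, {subset B1 <= B}
    & flip_set B n (word_prod Phi B1) = S].
Proof.
move=> oB sz; have [_ uB _] := oB.
have nthI : injective (fun i : 'I_n => B`_i).
  by move=> i j /eqP; rewrite nth_uniq ?sz// => /eqP/val_inj.
have subS : {subset [seq B`_i | i : 'I_n <- enum S] <= B}.
  by move=> b /mapP[i _ ->]; rewrite mem_nth// sz.
have uS : uniq [seq B`_i | i : 'I_n <- enum S] by rewrite map_inj_uniq ?enum_uniq.
exists [seq B`_i | i : 'I_n <- enum S]; split=> //.
by apply/setP => i; rewrite (flip_setE _ oB sz uS subS) (mem_map nthI) mem_enum.
Qed.

End BasedRootSystem.

Theorem theorem5p6 (R : realType) (V : vectType (complex R))
    (Phi : based_root_system V) (J : seq V)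
    (J_simple : {subset J <= simple_roots Phi})
    (v w : 'End(V)) (vw_ECR : ECR_P Phi J (v, w)) :
  (forall v' w' : 'End(V), weyl Phi v' -> weyl Phi w' ->
     ([/\ bruhat_le Phi v v', bruhat_le Phi v' w' & bruhat_le Phi w' w] <->
      [/\ P_bruhat_le Phi J v v', P_bruhat_le Phi J v' w'
        & P_bruhat_le Phi J w' w])) /\
  (exists f : 'End(V) -> {set 'I_(weyl_length Phi w - weyl_length Phi v)},
     set_bij (P_bruhat_interval Phi J v w) setT f /\
     forall x y : 'End(V),
       P_bruhat_interval Phi J v w x -> P_bruhat_interval Phi J v w y ->
       (P_bruhat_le Phi J x y <-> (f y \subset f x))).
Proof.
case: vw_ECR => -[/= Hv Hw vw dimE] [_ wJ].
have E : ecr Phi v w by split=> //; rewrite -dimE.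
have [B [bl el]] := ecr_boolean E.
have [oB fB sz vE _] := bl.
have uB : uniq B by case: oB.
have szB : size B = (weyl_length Phi w - weyl_length Phi v)%N by rewrite -sz addnK.
pose pt B1 := (word_prod Phi B1 \o w)%VF.
have ptw : w = pt nil by rewrite /pt word_prod_nil comp_lfun1l.
have le_pt B1 B2 : uniq B1 -> {subset B1 <= B} -> uniq B2 -> {subset B2 <= B} ->
    bruhat_le Phi (pt B1) (pt B2) -> P_bruhat_le Phi J (pt B1) (pt B2).
  move=> u1 s1 u2 s2 le; apply: (point_P_le Hw bl wJ) => //.
  exact: (point_le_sub Hw bl).
have le_ptP B1 B2 : uniq B1 -> {subset B1 <= B} -> uniq B2 -> {subset B2 <= B} ->
    P_bruhat_le Phi J (pt B1) (pt B2) <-> {subset B2 <= B1}.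
  move=> u1 s1 u2 s2; split=> [/P_bruhat_le_bruhat|].
    exact: (point_le_sub Hw bl).
  exact: (point_P_le Hw bl wJ).
split.
  move=> v' w' _ _; split=> [[vv' vw' ww']|[/P_bruhat_le_bruhat ? ]]; last first.
    by move=> /P_bruhat_le_bruhat ? /P_bruhat_le_bruhat.
  have [B1 [u1 s1 v'E]] := el v' vv' (bruhat_trans vw' ww').
  have [B2 [u2 s2 w'E]] := el w' (bruhat_trans vv' vw') ww'.
  rewrite v'E w'E in vv' vw' ww' *; split.
  - by rewrite {1}vE; apply: le_pt => //; rewrite /pt -vE.
  - exact: le_pt.
  - by have := @le_pt B2 nil; rewrite -ptw; apply.
have int B1 : uniq B1 -> {subset B1 <= B} -> P_bruhat_interval Phi J v w (pt B1).
  move=> u1 s1; split; first exact: (point_weyl Hw bl).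
    by rewrite vE; apply/le_ptP.
  by have := @le_ptP B1 nil; rewrite -ptw => ->.
have intP x : P_bruhat_interval Phi J v w x ->
    exists B1, [/\ uniq B1, {subset B1 <= B} & x = pt B1].
  by case=> _ /P_bruhat_le_bruhat vx /P_bruhat_le_bruhat xw; exact: el.
pose f x := flip_set B (weyl_length Phi w - weyl_length Phi v) (x \o w^-1)%VF.
have fE B1 : f (pt B1) =
    flip_set B (weyl_length Phi w - weyl_length Phi v) (word_prod Phi B1).
  by rewrite /f (weyl_mulgKV Hw (erefl (pt B1))).
have fS B1 B2 : uniq B1 -> {subset B1 <= B} -> uniq B2 -> {subset B2 <= B} ->
    (f (pt B2) \subset f (pt B1)) <-> {subset B2 <= B1}.
  by move=> *; rewrite !fE; apply: flip_set_subset.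
exists f; split; last first.
  move=> x y /intP[B1 [u1 s1 ->]] /intP[B2 [u2 s2 ->]].
  by rewrite le_ptP// fS.
split=> //.
- move=> x y; rewrite !inE => /intP[B1 [u1 s1 ->]] /intP[B2 [u2 s2 ->]] fxy.
  apply: (point_perm bl) => //; apply: uniq_perm => // b.
  have s12 : {subset B2 <= B1} by apply/fS => //; rewrite fxy.
  have s21 : {subset B1 <= B2} by apply/fS => //; rewrite fxy.
  by apply/idP/idP; [exact: s21|exact: s12].
- move=> S _; have [B1 [u1 s1 SE]] := flip_set_onto S oB szB.
  by exists (pt B1); [exact: int|rewrite fE].
Qed.
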